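(* Let $p\ge2$ be an integer, $\pi$ a $p$-adic permutation, $k\ge0$ an integer, and let $S=([a_0],\dots,[a_{r-1}])$ be (a representative of) a cycle of length $r$ of $\pi_k$. Then there are $m\in\{1,\dots,p\}$, positive integers $s_0,\dots,s_{m-1}$ with $s_n/r\in\{1,\dots,p\}$ (in particular $r\mid s_n$) for all $n\in\{0,\dots,m-1\}$ and $\sum_{n=0}^{m-1}s_n/r=p$, and $m$ pairwise distinct cycles of $\pi_{k+1}$ (the children of $S$), represented by $$([b_{0,0}],\dots,[b_{0,s_0-1}]),\ \dots,\ ([b_{m-1,0}],\dots,[b_{m-1,s_{m-1}-1}]),$$ such that $$a_i\equiv b_{n,jr+i}\pmod{p^k}\quad\text{for all } n\in\{0,\dots,m-1\},\ i\in\{0,\dots,r-1\},\ j\in\{0,\dots,s_n/r-1\}.$$ In particular, the set of cycles of $\pi_{k+1}$ is the disjoint union of the sets of children of all cycles of $\pi_k$.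
   Context: $p\ge2$ is an integer, not necessarily prime, and $\mathbb{Z}_p=\varprojlim \mathbb{Z}/p^k\mathbb{Z}$. A $p$-adic permutation is a permutation $\pi$ of $\mathbb{Z}_p$ such that $\pi(n)\equiv n\pmod p$ for all $n\in\mathbb{Z}_p$, and for all integers $k\ge1$ and all $m,n\in\mathbb{Z}_p$: $m\equiv n\pmod{p^k}\Leftrightarrow\pi(m)\equiv\pi(n)\pmod{p^k}$. For $k\ge0$ it induces the permutation $\pi_k$ of $\mathbb{Z}_p/p^k\mathbb{Z}_p$, $[n]\mapsto[\pi(n)]$. Cycles of a permutation of a finite set (including fixed points, which are cycles of length $1$) are regarded as finite sequences of distinct elements, each entry being mapped to the cyclically next one, up to cyclic shift. *)

(* Defs.v *)
From HB Require Import structures.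
From mathcomp Require Import all_boot all_algebra.
From mathcomp Require Import perm ring_quotient boolp classical_sets.

Set Implicit Arguments.
Unset Strict Implicit.
Unset Printing Implicit Defensive.

Import GRing.Theory.
Local Open Scope ring_scope.
Local Open Scope quotient_scope.

(* 'I_(residue_size p k) is Z/p^k: its size is p ^ k as soon as p > 0, and it
   is written as a successor so that zmodp's modular arithmetic applies to it.
   'Z_(p ^ k) would be wrong for k = 0, where it is Z/2. *)
Definition residue_size (p k : nat) : nat := (p ^ k)%N.-1.+1.

Lemma residue_sizeE p k : (0 < p)%N -> residue_size p k = (p ^ k)%N.
Proof. by move=> p0; rewrite /residue_size prednK // expn_gt0 p0. Qed.

Lemma residue_size_dvd p k : (residue_size p k %| residue_size p k.+1)%N.
Proof.
case: p => [|p]; last by rewrite !residue_sizeE // expnS dvdn_mull.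
by case: k => [|k] //; rewrite /residue_size !exp0n.
Qed.

(* The inverse limit of the Z/p^k along the reductions Z/p^(k+1) -> Z/p^k. *)
Definition coherent p (x : forall k, 'I_(residue_size p k)) : Prop :=
  forall k, inZp (x k.+1) = x k.

Record padic_int (p : nat) := PadicInt {
  residue : forall k, 'I_(residue_size p k);
  residue_coherent : `[< coherent residue >] }.

HB.instance Definition _ p := [isSub for @residue p].
HB.instance Definition _ p := [Choice of padic_int p by <:].

Section ZpRing.
Variable p : nat.
Implicit Types x y z : padic_int p.

Lemma residueP x k : (x.(residue) k.+1 = x.(residue) k %[mod residue_size p k])%N.
Proof.
have /asboolP/(_ k) <- := residue_coherent x.
by rewrite /= modn_mod.
Qed.

Lemma padic_int_ext x y : (forall k, residue x k = residue y k) -> x = y.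
Proof. by move=> xy; apply/val_inj/functional_extensionality_dep. Qed.

Lemma inZp_modr k (n : nat) :
  inZp (n %% residue_size p k.+1) = inZp n :> 'I_(residue_size p k).
Proof. by apply: val_inj; rewrite /= modn_dvdm // residue_size_dvd. Qed.

Lemma coherentP (x : forall k, 'I_(residue_size p k)) :
  (forall k, (x k.+1 = x k %[mod residue_size p k])%N) -> `[< coherent x >].
Proof. by move=> h; apply/asboolP => k; apply: val_inj; rewrite /= h modZp. Qed.

Lemma zero_coherent : `[< coherent (fun k => Zp0 : 'I_(residue_size p k)) >].
Proof. by apply: coherentP => k. Qed.

Lemma one_coherent : `[< coherent (fun k => inZp 1 : 'I_(residue_size p k)) >].
Proof. by apply/asboolP => k; rewrite /= inZp_modr. Qed.

Lemma opp_coherent x : `[< coherent (fun k => Zp_opp (residue x k)) >].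
Proof.
apply: coherentP => k /=.
rewrite modn_dvdm ?residue_size_dvd// modn_mod.
apply/eqP; rewrite -(eqn_modDr (residue x k.+1)) subnK; last exact/ltnW.
rewrite -modnDmr (residueP x) modnDmr subnK ?modnn; last exact/ltnW.
exact: residue_size_dvd.
Qed.

Lemma add_coherent x y :
  `[< coherent (fun k => Zp_add (residue x k) (residue y k)) >].
Proof.
apply: coherentP => k /=.
by rewrite modn_dvdm ?residue_size_dvd// modn_mod -modnDm !residueP modnDm.
Qed.

Lemma mul_coherent x y :
  `[< coherent (fun k => Zp_mul (residue x k) (residue y k)) >].
Proof.
apply: coherentP => k /=.
by rewrite modn_dvdm ?residue_size_dvd// modn_mod -modnMm !residueP modnMm.
Qed.

Definition zp_zero : padic_int p := PadicInt zero_coherent.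
Definition zp_one : padic_int p := PadicInt one_coherent.
Definition zp_opp x : padic_int p := PadicInt (opp_coherent x).
Definition zp_add x y : padic_int p := PadicInt (add_coherent x y).
Definition zp_mul x y : padic_int p := PadicInt (mul_coherent x y).

Lemma zp_addA : associative zp_add.
Proof. by move=> x y z; apply: padic_int_ext => k; apply: Zp_addA. Qed.
Lemma zp_addC : commutative zp_add.
Proof. by move=> x y; apply: padic_int_ext => k; apply: Zp_addC. Qed.
Lemma zp_add0 : left_id zp_zero zp_add.
Proof. by move=> x; apply: padic_int_ext => k; apply: Zp_add0z. Qed.
Lemma zp_addN : left_inverse zp_zero zp_opp zp_add.
Proof. by move=> x; apply: padic_int_ext => k; apply: Zp_addNz. Qed.

HB.instance Definition _ :=
  GRing.isZmodule.Build (padic_int p) zp_addA zp_addC zp_add0 zp_addN.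

Lemma zp_mulA : associative zp_mul.
Proof. by move=> x y z; apply: padic_int_ext => k; apply: Zp_mulA. Qed.
Lemma zp_mulC : commutative zp_mul.
Proof. by move=> x y; apply: padic_int_ext => k; apply: Zp_mulC. Qed.
Lemma zp_mul1 : left_id zp_one zp_mul.
Proof. by move=> x; apply: padic_int_ext => k; apply: Zp_mul1z. Qed.
Lemma zp_mulD : left_distributive zp_mul +%R.
Proof. by move=> x y z; apply: padic_int_ext => k; apply: Zp_mul_addl. Qed.

HB.instance Definition _ :=
  GRing.Zmodule_isComPzRing.Build (padic_int p) zp_mulA zp_mulC zp_mul1 zp_mulD.

Definition pk_ideal (k : nat) : {pred padic_int p} :=
  fun x => `[< exists y, x = (p ^ k)%:R * y >].

Lemma pk_ideal_zmod_closed k : zmod_closed (pk_ideal k).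
Proof.
split=> [|x y /asboolP[u ->] /asboolP[v ->]]; apply/asboolP.
  by exists 0; rewrite mulr0.
by exists (u - v); rewrite mulrBr.
Qed.

HB.instance Definition _ k :=
  GRing.isZmodClosed.Build (padic_int p) (pk_ideal k) (pk_ideal_zmod_closed k).

Definition congr_mod (k : nat) x y : Prop := x - y \in pk_ideal k.

(* Z_p / p^k Z_p, with class map cls *)
Definition padic_mod (k : nat) := Quotient.quot (pk_ideal k).

HB.instance Definition _ k := Choice.on (padic_mod k).
HB.instance Definition _ k := GRing.Zmodule.on (padic_mod k).

Definition cls (k : nat) x : padic_mod k := \pi_(Quotient.quot (pk_ideal k)) x.

Lemma cls_eq k x y : cls k x = cls k y <-> congr_mod k x y.
Proof. by rewrite /congr_mod Quotient.idealrBE; split=> /eqP. Qed.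

Lemma cls_repr k (c : padic_mod k) : exists x, c = cls k x.
Proof. by exists (repr (c : Quotient.quot (pk_ideal k))); rewrite /cls reprK. Qed.

Lemma residueB x y k : residue (x - y) k = residue x k - residue y k.
Proof. by []. Qed.

Lemma residue_natM n x k :
  residue (n%:R * x) k = (n * residue x k %% residue_size p k)%N :> nat.
Proof.
rewrite mulr_natl; elim: n => [|n IHn]; first by rewrite mulr0n mod0n.
by rewrite mulrS /= IHn modnDmr mulSn.
Qed.

Lemma residueD x j k :
  (residue x (j + k) = residue x k %[mod residue_size p k])%N.
Proof.
elim: j => [|j IHj] //; rewrite -IHj.
have dvd : (residue_size p k %| residue_size p (j + k))%N.
  by elim: j {IHj} => [|j IHj] //; apply: dvdn_trans IHj (residue_size_dvd _ _).
by rewrite -(modn_dvdm _ dvd) residueP modn_dvdm.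
Qed.

Lemma pk_idealP k x : x \in pk_ideal k <-> residue x k = 0.
Proof.
split=> [/asboolP[y ->]|xk0].
  apply: val_inj; rewrite [LHS]residue_natM -[RHS]/0%N; case: (posnP p) => [p0|p0].
    have h : residue_size p k = 1%N.
      by rewrite /residue_size p0; case: k => [|k] //; rewrite exp0n.
    by move: (_ * _)%N => n; rewrite h modn1.
  by rewrite -(residue_sizeE k p0) modnMr.
apply/asboolP; case: (posnP p) => [p0|p0].
  exists 0; rewrite mulr0; apply: padic_int_ext => j.
  have h : residue_size p j = 1%N.
    by rewrite /residue_size p0; case: j => [|j] //; rewrite exp0n.
  by apply: val_inj => /=; case: (residue x j) => i; rewrite /= h; case: i.
pose y j : 'I_(residue_size p j) := inZp (residue x (j + k) %/ p ^ k)%N.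
have yP : `[< coherent y >].
  apply/asboolP => j; rewrite /y inZp_modr; apply: val_inj.
  rewrite -[LHS]/((residue x (j.+1 + k) %/ p ^ k) %% residue_size p j)%N.
  rewrite -[RHS]/((residue x (j + k) %/ p ^ k) %% residue_size p j)%N.
  have := residueP x (j + k); rewrite -[(j + k).+1]/(j.+1 + k)%N.
  move: (residue x _ : nat) (residue x _ : nat) => a b.
  by rewrite !(residue_sizeE _ p0) !modn_divl -expnD => ->.
exists (PadicInt yP); apply: padic_int_ext => j; apply: val_inj.
rewrite [RHS]residue_natM /=.
have dvd : (p ^ k %| residue x (j + k))%N.
  by rewrite /dvdn -residue_sizeE // residueD xk0 mod0n.
rewrite modnMmr mulnC divnK // addnC.
by rewrite [RHS](residueD x k j) modZp.
Qed.

Lemma congr_modP k x y : congr_mod k x y <-> residue x k = residue y k.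
Proof.
rewrite /congr_mod pk_idealP residueB; split=> [/eqP|->]; last exact: subrr.
by rewrite subr_eq0 => /eqP.
Qed.

Lemma residue_nat n k : residue n%:R k = (n %% residue_size p k)%N :> nat.
Proof. by have := residue_natM n 1 k; rewrite mulr1 /= modnMmr muln1. Qed.

(* Z_p / p^k Z_p is finite, in bijection with Z/p^k *)
Definition cls_residue k (c : padic_mod k) : 'I_(residue_size p k) :=
  residue (repr (c : Quotient.quot (pk_ideal k))) k.

Lemma cls_residueE k x : cls_residue (cls k x) = residue x k.
Proof. by apply/congr_modP/cls_eq; rewrite /cls reprK. Qed.

Definition residue_cls k (i : 'I_(residue_size p k)) : padic_mod k :=
  cls k (i : nat)%:R.

Lemma cls_residueK k : cancel (@cls_residue k) (@residue_cls k).
Proof.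
move=> c; have [x ->] := cls_repr c; rewrite cls_residueE.
by apply/cls_eq/congr_modP/val_inj; rewrite [LHS]residue_nat modZp.
Qed.

Lemma residue_clsK k : cancel (@residue_cls k) (@cls_residue k).
Proof.
by move=> i; rewrite cls_residueE; apply/val_inj; rewrite [LHS]residue_nat modZp.
Qed.

HB.instance Definition _ k := CanIsCountable (@cls_residueK k).
HB.instance Definition _ k : isFinite (padic_mod k) :=
  CanIsFinite (@cls_residueK k).

Lemma card_padic_mod k : #|{: padic_mod k}| = residue_size p k.
Proof.
by rewrite -[RHS]card_ord (bij_eq_card (Bijective (@cls_residueK k) (@residue_clsK k))).
Qed.

Lemma congr_mod0 x y : congr_mod 0 x y.
Proof. by apply/congr_modP; rewrite [LHS]ord1 [RHS]ord1. Qed.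

End ZpRing.

Record padic_perm (p : nat) := PadicPerm {
  padic_fun :> padic_int p -> padic_int p;
  padic_bij : bijective padic_fun;
  padic_digit0 : forall n, congr_mod 1 (padic_fun n) n;
  padic_congr : forall k m n, (1 <= k)%N ->
    congr_mod k m n <-> congr_mod k (padic_fun m) (padic_fun n) }.

Section Induced.
Variables (p : nat) (pi : padic_perm p) (k : nat).

Lemma padic_congr_all m n : congr_mod k m n <-> congr_mod k (pi m) (pi n).
Proof.
case: (posnP k) => [->|k0]; last exact: padic_congr.
by split=> _; apply: congr_mod0.
Qed.

Definition induced_fun (c : padic_mod p k) : padic_mod p k :=
  cls k (pi (repr (c : Quotient.quot (pk_ideal k)))).

Lemma induced_funE n : induced_fun (cls k n) = cls k (pi n).
Proof.
apply/cls_eq; apply: (proj1 (padic_congr_all _ _)).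
by apply/cls_eq; rewrite /cls reprK.
Qed.

Lemma induced_fun_inj : injective induced_fun.
Proof.
move=> c d; have [m ->] := cls_repr c; have [n ->] := cls_repr d.
rewrite !induced_funE => /cls_eq h.
by apply/cls_eq; apply: (proj2 (padic_congr_all _ _)).
Qed.

Definition induced : {perm padic_mod p k} := perm induced_fun_inj.

Lemma inducedE n : induced (cls k n) = cls k (pi n).
Proof. by rewrite permE induced_funE. Qed.

End Induced.

Local Open Scope classical_set_scope.

Section Cycles.
Variables (T : finType) (s : {perm T}).

(* ufcycle holds of the empty sequence, which represents no cycle. *)
Definition is_cycle (c : seq T) : Prop := c != [::] /\ ufcycle s c.

(* A cycle, i.e. a sequence up to cyclic shift, is the set of its shifts. *)
Definition shift_class (c : seq T) : set (seq T) :=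
  [set rot n c | n in [set: nat]].

Definition cycles : set (set (seq T)) :=
  [set shift_class c | c in [set c | is_cycle c]].

End Cycles.

(* The sequence ([a 0], ..., [a (r - 1)]); only the first r values of a matter. *)
Definition cls_seq p k (a : nat -> padic_int p) (r : nat) : seq (padic_mod p k) :=
  mkseq (fun i => cls k (a i)) r.

Definition lies_over p k (a : nat -> padic_int p) r (b : nat -> padic_int p) s : Prop :=
  (r %| s)%N /\ forall i j, (i < r)%N -> (j < s %/ r)%N ->
    congr_mod k (a i) (b (j * r + i)%N).

(* The cycles of the level k + 1 permutation that wind over the cycle C of the
   level k permutation: suitable representatives reduce mod p^k to a
   representative of C repeated s / r times. *)
Definition children p (pi : padic_perm p) k (C : set (seq (padic_mod p k))) :
    set (set (seq (padic_mod p k.+1))) :=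
  [set D | exists a r b s,
    [/\ is_cycle (induced pi k) (cls_seq k a r),
        C = shift_class (cls_seq k a r),
        is_cycle (induced pi k.+1) (cls_seq k.+1 b s),
        D = shift_class (cls_seq k.+1 b s)
      & lies_over k a r b s]].

(* Main.v *)
(* Reduction mod p^k intertwines the level k + 1 permutation with the level k
   one, and all its fibres have p elements. Fix a cycle of length r of the level
   k permutation, a point y on it and the fibre F over y. Every cycle upstairs
   over that cycle meets F, and, starting from a point of F, it returns to F
   exactly at the multiples of r; so a cycle of length s meets F in s / r points.
   Choosing one point of F on each of these cycles gives the representatives,
   and the s / r sum up to #|F| = p. *)
Require Import Defs.
From mathcomp Require Import all_boot all_algebra.
From mathcomp Require Import perm boolp classical_sets.

Set Implicit Arguments.
Unset Strict Implicit.
Unset Printing Implicit Defensive.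

Local Open Scope nat_scope.

(** * One representative in a finite set for each orbit that meets it *)

Section OrbitRepresentatives.
Variables (T : finType) (f : T -> T).
Hypothesis f_inj : injective f.

Lemma fconnectC (x y : T) : fconnect f x y = fconnect f y x.
Proof. exact: fconnect_sym. Qed.

(** Whole turns around the orbit can be removed from [i]. The remainder is smaller than the order,
    so it is the [findex] of the point reached, which is 0 exactly when that point is [x]. *)
Lemma iter_order_dvdn (x : T) (i : nat) :
  (iter i f x == x) = (order f x %| i).
Proof.
have itermul j : iter (j * order f x) f x = x.
  by elim: j => [|j IHj] //; rewrite mulSn iterD IHj iter_order.
apply/eqP/idP => [|/dvdnP[j ->]]; last exact: itermul.
rewrite {1}(divn_eq i (order f x)) addnC iterD itermul => imod.
have lt_mod : i %% order f x < order f x by rewrite ltn_mod order_gt0.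
by have := findex_iter lt_mod; rewrite imod findex0 /dvdn => <-.
Qed.

Lemma orbit_representatives (F : {set T}) :
  exists (m : nat) (x : 'I_m -> T),
    [/\ forall n, x n \in F,
        forall n n', fconnect f (x n) (x n') -> n = n',
        forall z, z \in F -> exists n, fconnect f (x n) z &
        \sum_(n < m) #|[set z in F | fconnect f (x n) z]| = #|F|].
Proof.
(* [c] selects a point of [F] on the orbit of [z]. For [z] in [F] the pick succeeds, so the default
   is never reached. Connected points give equivalent predicates, hence the same pick, so the image
   of [c] on [F] holds one point per orbit. *)
pose c z := odflt z [pick w in F | fconnect f z w].
have cP z : z \in F -> c z \in F /\ fconnect f z (c z).
  move=> zF; rewrite /c; case: pickP => [w /andP[]//|/(_ z)].
  by rewrite zF connect0.
have ceq z w : z \in F -> fconnect f z w -> c z = c w.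
  move=> zF zw; rewrite /c.
  have -> : [pick u in F | fconnect f w u] = [pick u in F | fconnect f z u].
    by apply: eq_pick => u /=; rewrite (same_connect fconnectC zw).
  by case: pickP => [//|/(_ z)]; rewrite zF connect0.
exists #|c @: F|, (fun n => enum_val n).
have imP (n : 'I_#|c @: F|) : exists2 z, z \in F & enum_val n = c z.
  by have /imsetP[z zF ->] := enum_valP n; exists z.
have xF (n : 'I_#|c @: F|) : enum_val n \in F.
  by have [z zF ->] := imP n; have [] := cP _ zF.
have xc (n : 'I_#|c @: F|) : c (enum_val n) = enum_val n.
  have [z zF ->] := imP n; have [? zc] := cP _ zF.
  by apply/esym/ceq.
split=> //.
- by move=> n n' /(ceq _ _ (xF n)); rewrite !xc => /enum_val_inj.
- move=> z zF; have cz : c z \in c @: F by apply: imset_f.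
  exists (enum_rank_in cz (c z)); rewrite enum_rankK_in // fconnectC.
  by have [] := cP _ zF.
(* The points of [F] are counted by grouping them according to their value under [c]. *)
- rewrite -[RHS]sum1_card (partition_big_imset c) [RHS]big_enum_val /=.
  Show.   apply: eq_bigr => n _; rewrite -sum1_card; apply: eq_bigl => z.
  rewrite inE; apply/andb_id2l => zF; apply/idP/eqP => [h|<-].
    by rewrite -(ceq _ _ (xF n) h) xc.
  by rewrite fconnectC; have [] := cP _ zF.
Qed.

End OrbitRepresentatives.

(** * Orbits of two injective maps intertwined by [h] *)

Section Semiconjugacy.
Variables (X Y : finType) (f : X -> X) (g : Y -> Y) (h : X -> Y).
Hypotheses (f_inj : injective f) (g_inj : injective g).
Hypothesis hf : forall x, h (f x) = g (h x).

Lemma semiconj_iter i x : h (iter i f x) = iter i g (h x).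
Proof. by elim: i => [|i IHi] //=; rewrite hf IHi. Qed.

Lemma semiconj_fconnect x y : fconnect f x y -> fconnect g (h x) (h y).
Proof. by move=> /iter_findex <-; rewrite semiconj_iter fconnect_iter. Qed.

Lemma semiconj_order_dvdn x : order g (h x) %| order f x.
Proof. by rewrite -iter_order_dvdn // -semiconj_iter iter_order. Qed.

(** The iterate [iter i f x] has the same image under [h] as [x] exactly when [r] divides [i]. The
    points sought are therefore the iterates at [j * r] with [j < s %/ r], distinct because their
    exponents are below the order [s]. *)
Lemma card_orbit_fiber x :
  #|[set z in [set z | h z == h x] | fconnect f x z]|
    = order f x %/ order g (h x).
Proof.
set r := order g (h x); set s := order f x.
have rs : s %/ r * r = s by rewrite divnK // semiconj_order_dvdn.
have r0 : 0 < r by apply: order_gt0.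
pose e := [seq iter (j * r) f x | j <- iota 0 (s %/ r)].
have eU : uniq e.
  rewrite map_inj_in_uniq ?iota_uniq // => i j; rewrite !mem_iota /= !add0n.
  rewrite -(ltn_pmul2r r0) rs => ilt; rewrite -(ltn_pmul2r r0) rs => jlt.
  move=> /(congr1 (findex f x)).
  by rewrite !findex_iter // => /eqP; rewrite eqn_pmul2r // => /eqP.
transitivity (size e); last by rewrite size_map size_iota.
rewrite -(card_uniqP eU); apply: eq_card => z.
rewrite !inE; apply/andP/mapP => [[/eqP hz xz]|[j _ ->]]; last first.
  by rewrite fconnect_iter semiconj_iter iter_order_dvdn // dvdn_mull.
have := iter_findex xz; have := findex_max xz; set i := findex f x z => ilt zE.
have ri : r %| i by rewrite -iter_order_dvdn // -semiconj_iter zE hz.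
exists (i %/ r); last by rewrite divnK.
by rewrite mem_iota /= add0n -(ltn_pmul2r r0) rs divnK.
Qed.

End Semiconjugacy.

Local Open Scope classical_set_scope.

(** * Cycles up to shift as orbits *)

Section ShiftClasses.
Variables (T : finType) (s : {perm T}).
Implicit Types (x y : T) (c : seq T).

Lemma orbit_is_cycle x : is_cycle s (orbit s x).
Proof.
split; first by rewrite -size_eq0 size_orbit -lt0n order_gt0.
apply/andP; split; last exact: orbit_uniq.
by apply: cycle_orbit; apply: perm_inj.
Qed.

Lemma shift_class_rot i c : shift_class (rot i c) = shift_class c.
Proof.
have sub j (d : seq T) : shift_class (rot j d) `<=` shift_class d.
  (* Composing two rotations by [rot_add_mod] requires both amounts to be at most the size; larger
     rotations are trivial. *)
  move=> _ [n _ <-] /=; have [le_j|/ltnW le_j] := leqP j (size d); last first.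
    by rewrite (rot_oversize le_j); exists n.
  have [le_n|/ltnW le_n] := leqP n (size d); last first.
    by rewrite rot_oversize ?size_rot //; exists j.
  by rewrite rot_add_mod //; eexists.
apply/seteqP; split; first exact: sub.
(* The inverse of a rotation is again a rotation, so the first inclusion gives the second. *)
by rewrite -{1}(rotK i c) /rotr; apply: sub.
Qed.

Lemma shift_class_orbit c x :
  is_cycle s c -> x \in c -> shift_class c = shift_class (orbit s x).
Proof.
move=> [_ /andP[cyc_c uniq_c]] xc.
by have [i ->] := orbit_rot_cycle cyc_c uniq_c xc; rewrite shift_class_rot.
Qed.

(** This turns identities between cycles into connectedness of points, the form in which they are
    transported along the reduction. *)
Lemma shift_class_orbitP x y :
  shift_class (orbit s x) = shift_class (orbit s y) <-> fconnect s x y.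
Proof.
split=> [eq_xy|xy].
  have [n _ xE] : shift_class (orbit s x) (orbit s y).
    by rewrite eq_xy; exists 0; rewrite ?rot0.
  by rewrite fconnect_orbit -(mem_rot n) xE in_orbit.
by apply: shift_class_orbit; [apply: orbit_is_cycle|rewrite -fconnect_orbit].
Qed.

Lemma cycles_orbitP C : cycles s C <-> exists x, C = shift_class (orbit s x).
Proof.
split=> [[[|x c] cyc <-]|[x ->]]; first by case: cyc.
  by exists x; apply: shift_class_orbit; rewrite ?mem_head.
by exists (orbit s x) => //; apply: orbit_is_cycle.
Qed.

End ShiftClasses.

(** * Reduction from level [k + 1] to level [k] and its fibres *)

Section Reduction.
Variables (p : nat) (k : nat).

Definition reduce (c : padic_mod p k.+1) : padic_mod p k :=
  residue_cls (inZp (cls_residue c)).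

Lemma reduceE x : reduce (cls k.+1 x) = cls k x.
Proof.
rewrite /reduce cls_residueE -(cls_residueK (cls k x)) cls_residueE.
by have /asboolP/(_ k) -> := residue_coherent x.
Qed.

(** With [q = p ^ k] and [a] the residue of [c], the lifts of [c] have the residues [j * q + a] for
    [j < p]; Euclidean division by [q] recovers [j]. *)
Lemma card_reduce_fiber (p0 : 0 < p) (c : padic_mod p k) :
  #|[set z | reduce z == c]%SET| = p.
Proof.
pose q := p ^ k; have q0 : 0 < q by rewrite expn_gt0 p0.
have qE : residue_size p k = q by rewrite residue_sizeE.
have pqE : residue_size p k.+1 = p * q by rewrite residue_sizeE // expnS.
pose a : nat := cls_residue c.
have a_lt : a < q by rewrite -qE ltn_ord.
have lt_pq (j : 'I_p) : j * q + a < p * q.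
  apply: (@leq_trans (j.+1 * q)); last by rewrite leq_mul2r ltn_ord orbT.
  by rewrite mulSn addnC ltn_add2r.
pose e (j : 'I_p) : padic_mod p k.+1 := residue_cls (inZp (j * q + a)).
have eE j : cls_residue (e j) = j * q + a :> nat.
  by rewrite residue_clsK -[LHS]/((j * q + a) %% residue_size p k.+1) pqE modn_small.
have e_inj : injective e.
  move=> i j /(congr1 (fun z => cls_residue z : nat)); rewrite !eE.
  by move=> /addIn/eqP; rewrite eqn_pmul2r // => /eqP/val_inj.
rewrite -[RHS]card_ord -(card_imset _ e_inj); apply: eq_card => z.
rewrite !inE; apply/eqP/imsetP => [zc|[j _ ->]].
  pose i : nat := cls_residue z.
  have i_lt : i %/ q < p by rewrite ltn_divLR // -pqE ltn_ord.
  exists (Ordinal i_lt) => //.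
  apply/(can_inj (@cls_residueK p k.+1))/val_inj; rewrite [RHS]eE /=.
  have <- : i %% q = a by rewrite /a -zc residue_clsK -qE.
  exact: divn_eq.
apply/(can_inj (@cls_residueK p k))/val_inj.
have := modn_small a_lt; rewrite -(modnMDl j) -eE -qE => modE.
rewrite residue_clsK; exact: modE.
Qed.

Lemma congr_mod_cls (x y : padic_int p) :
  cls k x = cls k y -> congr_mod k x y.
Proof. by move/cls_eq. Qed.

End Reduction.

(** * Cycles of classes as trajectories *)

Section Children.
Variables (p : nat) (pi : padic_perm p) (k : nat).

Lemma cls_iter x i :
  cls k (iter i pi x) = iter i (induced pi k) (cls k x).
Proof. by elim: i => [|i IHi] //=; rewrite -IHi inducedE. Qed.

Lemma cls_seq_iter x :
  cls_seq k (fun i => iter i pi x) (order (induced pi k) (cls k x))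
    = orbit (induced pi k) (cls k x).
Proof.
apply: (@eq_from_nth _ (cls k x)); first by rewrite size_mkseq size_orbit.
by move=> i; rewrite size_mkseq => lt_i; rewrite nth_mkseq // nth_traject // cls_iter.
Qed.

(** The path condition determines every entry from the first one, and a duplicate-free cycle has the
    order of any of its points as length. *)
Lemma cls_seq_cycle (a : nat -> padic_int p) r :
  is_cycle (induced pi k) (cls_seq k a r) ->
  [/\ 0 < r, r = order (induced pi k) (cls k (a 0)),
      cls k (a 0) \in cls_seq k a r &
      forall i, i < r -> cls k (a i) = iter i (induced pi k) (cls k (a 0))].
Proof.
case: r => [[]//|r] cyc; set t := induced pi k; set y := cls k (a 0).
have yin : y \in cls_seq k a r.+1 by apply: mem_head.
have [_ /andP[cyc_c uniq_c]] := cyc.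
have rE : r.+1 = order t y.
  by rewrite (order_cycle cyc_c uniq_c yin) size_mkseq.
split=> // i lt_i.
have -> : cls k (a i) = nth y (cls_seq k a r.+1) i by rewrite nth_mkseq.
suff -> : cls_seq k a r.+1 = traject t y r.+1 by rewrite nth_traject.
move: cyc_c; rewrite /cls_seq /mkseq /= -/y rcons_path => /andP[/fpathP[n nE] _].
rewrite nE; congr (_ :: traject _ _ _).
by have := congr1 size nE; rewrite size_traject size_map size_iota.
Qed.

End Children.

(** * Children described by reduction of points *)

Section ChildrenReduce.
Variables (p : nat) (pi : padic_perm p) (k : nat).

Lemma reduce_induced (c : padic_mod p k.+1) :
  reduce (induced pi k.+1 c) = induced pi k (reduce c).
Proof.
by have [x ->] := cls_repr c; rewrite inducedE !reduceE inducedE.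
Qed.

(** This removes the choice of representatives [a] and [b] from the definition of [children]: only
    one point upstairs and its reduction remain. *)
Lemma childrenP (y : padic_mod p k) D :
  children pi (shift_class (orbit (induced pi k) y)) D <->
  exists2 x, fconnect (induced pi k) y (reduce x)
           & D = shift_class (orbit (induced pi k.+1) x).
Proof.
split=> [[a [r [b [s [cyc_a yE cyc_b -> [rs ab]]]]]]|[c]].
  have [r0 _ a_in _] := cls_seq_cycle cyc_a.
  have [s0 _ b_in _] := cls_seq_cycle cyc_b.
  exists (cls k.+1 (b 0)); last exact: shift_class_orbit cyc_b b_in.
  have sr0 : 0 < s %/ r by rewrite divn_gt0 // dvdn_leq.
  have /cls_eq := ab 0 0 r0 sr0; rewrite mul0n addn0 => abE.
  rewrite reduceE -abE; apply/shift_class_orbitP.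
  by rewrite yE; apply: shift_class_orbit cyc_a a_in.
have [x ->] := cls_repr c; rewrite reduceE => yx ->.
(* The same sequence of iterates of [pi] serves at both levels, cut off at the respective orders. *)
exists (fun i => iter i pi x), (order (induced pi k) (cls k x)).
exists (fun i => iter i pi x), (order (induced pi k.+1) (cls k.+1 x)).
rewrite !cls_seq_iter; split=> //; try exact: orbit_is_cycle.
- exact/shift_class_orbitP.
- split.
    rewrite -reduceE; apply: semiconj_order_dvdn reduce_induced _; exact: perm_inj.
  move=> i j _ _; apply: congr_mod_cls; rewrite !cls_iter addnC iterD.
  congr (iter _ _ _); apply/esym/eqP.
  by rewrite iter_order_dvdn ?dvdn_mull //; apply: perm_inj.
Qed.

Lemma cycles_children :
  cycles (induced pi k.+1) = \bigcup_(C in cycles (induced pi k)) children pi C.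
Proof.
apply/seteqP; split=> [D /cycles_orbitP[x ->]|D].
  exists (shift_class (orbit (induced pi k) (reduce x))).
    by apply/cycles_orbitP; eexists.
  by apply/childrenP; exists x; rewrite ?connect0.
case=> _ /cycles_orbitP[y ->] /childrenP[x _ ->].
by apply/cycles_orbitP; exists x.
Qed.

(** A common child supplies two connected points upstairs; their reductions are connected too, which
    joins the two parent orbits. *)
Lemma children_trivIset : trivIset (cycles (induced pi k)) (children pi (k := k)).
Proof.
move=> _ _ /cycles_orbitP[y ->] /cycles_orbitP[y' ->].
case=> D [/childrenP[x yx ->] /childrenP[x' yx' xx']].
apply/shift_class_orbitP.
move: xx' => /shift_class_orbitP /(semiconj_fconnect reduce_induced) xx'.
apply: connect_trans yx (connect_trans xx' _).
by rewrite fconnectC //; apply: perm_inj.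
Qed.

End ChildrenReduce.

Theorem theorem3p22 (p : nat) (hp : 2 <= p) (pi : padic_perm p) (k : nat) :
  (forall (r : nat) (a : nat -> padic_int p),
     is_cycle (induced pi k) (cls_seq k a r) ->
     exists (m : nat) (s : 'I_m -> nat) (b : 'I_m -> nat -> padic_int p),
       [/\ 1 <= m <= p,
           forall n, [/\ 0 < s n, r %| s n & 1 <= s n %/ r <= p],
           \sum_(n < m) s n %/ r = p,
           [/\ forall n, is_cycle (induced pi k.+1) (cls_seq k.+1 (b n) (s n)),
               injective (fun n => shift_class (cls_seq k.+1 (b n) (s n))) &
               forall C, children pi (shift_class (cls_seq k a r)) C <->
                 exists n, C = shift_class (cls_seq k.+1 (b n) (s n))] &
           forall n i j, i < r -> j < s n %/ r ->
             congr_mod k (a i) (b n (j * r + i))]) /\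
  cycles (induced pi k.+1) =
    \bigcup_(C in cycles (induced pi k)) children pi C /\
  trivIset (cycles (induced pi k)) (children pi (k := k)).
Proof.
split; last by split; [exact: cycles_children|exact: children_trivIset].
move=> r a cyc_a; have [r0 rE a_in aE] := cls_seq_cycle cyc_a.
have p0 : 0 < p by apply: ltnW.
set f := induced pi k.+1; set g := induced pi k; set y := cls k (a 0).
have f_inj : injective f by apply: perm_inj.
have g_inj : injective g by apply: perm_inj.
have hf := @reduce_induced p pi k.
pose F := [set z | reduce z == y]%SET.
have cardF : #|F| = p by apply: card_reduce_fiber.
have [m [x [xF x_inj x_onto x_sum]]] := orbit_representatives f_inj F.
have xy n : reduce (x n) = y by have := xF n; rewrite inE => /eqP.
(* The representatives are lifted to [p]-adic integers, whose iterates under [pi] give the sequences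
   [b n]. *)
have /choice[b0 b0E] : forall n, exists z, x n = cls k.+1 z.
  by move=> n; apply: cls_repr.
have sE n : cls_seq k.+1 (fun i => iter i pi (b0 n)) (order f (x n)) = orbit f (x n).
  by rewrite b0E cls_seq_iter.
have card_block n :
    #|[set z in F | fconnect f (x n) z]%SET| = order f (x n) %/ r.
  by rewrite /F -(xy n) (card_orbit_fiber f_inj g_inj hf) xy -rE.
have rs n : r %| order f (x n) by rewrite rE -/y -(xy n); apply: semiconj_order_dvdn.
have s_pos n : 0 < order f (x n) %/ r by rewrite divn_gt0 // dvdn_leq ?order_gt0.
have s_sum : \sum_(n < m) order f (x n) %/ r = p.
  apply: etrans cardF; rewrite -x_sum.
  by apply: eq_bigr => n _; rewrite card_block.
exists m, (fun n => order f (x n)), (fun n i => iter i pi (b0 n)); split=> //.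
(* An empty sum could not equal [p], so [m] is positive; every summand is at least 1, so [m] is at
   most [p]. *)
- apply/andP; split.
    case: (posnP m) => // m0; have := leq_trans p0 (eq_leq (esym s_sum)).
    by subst m; rewrite big_ord0.
  apply: leq_trans (eq_leq s_sum).
  by rewrite -[X in X <= _]card_ord -sum1_card; apply: leq_sum.
- move=> n; split; rewrite ?order_gt0 // s_pos /=.
  (* The quotient counts a subset of [F], which has [p] elements. *)
  apply: leq_trans (eq_leq cardF); rewrite -card_block subset_leq_card //.
  by apply/fintype.subsetP => z; rewrite inE => /andP[].
- split=> [n|n n'|C].
  + by rewrite sE; apply: orbit_is_cycle.
  + by rewrite !sE => /shift_class_orbitP /x_inj.
  + rewrite (shift_class_orbit cyc_a a_in).
    split=> [/childrenP[z yz ->]|[n ->]]; last first.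
      by rewrite sE; apply/childrenP; exists (x n); rewrite ?xy ?connect0.
    have zy : fconnect g (reduce z) y by rewrite fconnectC.
    (* Moving [z] forward by the number of steps that lead from its reduction to [y] reaches the
       fibre [F] without leaving the orbit of [z]. *)
    have wF : iter (findex g (reduce z) y) f z \in F.
      by rewrite inE (semiconj_iter hf) iter_findex.
    have [n nw] := x_onto _ wF; exists n; rewrite sE; apply/shift_class_orbitP.
    by apply: connect_trans (fconnect_iter f _ z) _; rewrite fconnectC //; exact: nw.
- move=> n i j lt_i _; apply: congr_mod_cls.
  rewrite aE // cls_iter -(reduceE k (b0 n)) -b0E xy addnC iterD.
  (* After removal of the common [i] steps, it remains that [j * r] steps fix [y], whose order is
     [r]. *)
  congr (iter _ _ _); apply/esym/eqP.
  by rewrite iter_order_dvdn // -rE dvdn_mull.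
Qed.
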